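(* The sum $C_n(\nu)=\sum_{l=1}^{n-1}\cos\frac{2\pi\nu l}{n}\cdot\csc\frac{\pi l}{n}$, where $n$ and $\nu$ are integers with $1<\nu<n$, admits the following asymptotic expansion: $$\sum_{l=1}^{n-1}\cos\frac{2\pi\nu l}{n}\cdot\csc\frac{\pi l}{n}=-\frac{2n}{\pi}\ln\!\left(2\sin\frac{\pi\nu}{n}\right)-\frac{\pi}{12n}\csc^2\frac{\pi\nu}{n}+n f(\nu)+\frac{7\pi^3}{21600\,n^3}+o(n^{-3}),\qquad n\to\infty,$$ where $$f(\nu)=-\frac1\pi\left\{4H_{2\nu}-2H_\nu-2\ln\nu-4\ln2-2\gamma-\frac{1}{12\nu^2}\right\}.$$ It may also be used as a very accurate approximation for $C_n(\nu)$, whose error rapidly tends to zero as $n\to\infty$.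
   Context: $H_m=1+\frac12+\cdots+\frac1m$ is the $m$-th harmonic number and $\gamma=\lim_{m\to\infty}(H_m-\ln m)$ is Euler's constant. *)

(* Defs.v *)
From Stdlib Require Import Reals.
From Coquelicot Require Import Coquelicot.

Open Scope R_scope.

Definition csc (x : R) : R := / sin x.

Definition harm (m : nat) : R := sum_n_m (fun k => / INR k) 1 m.

(* [Lim_seq] is total with values in [Rbar]; the limit here is finite, so the
   coercion [real] loses nothing. *)
Definition euler_gamma : R := real (Lim_seq (fun m => harm m - ln (INR m))).

Definition cos_csc_sum (n nu : nat) : R :=
  sum_n_m (fun l => cos (2 * PI * INR nu * INR l / INR n)
                    * csc (PI * INR l / INR n)) 1 (n - 1).

Definition f_nu (nu : nat) : R :=
  - (1 / PI) * (4 * harm (2 * nu) - 2 * harm nu - 2 * ln (INR nu) - 4 * ln 2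
                - 2 * euler_gamma - 1 / (12 * INR nu ^ 2)).

Definition cos_csc_approx (n nu : nat) : R :=
  - (2 * INR n / PI) * ln (2 * sin (PI * INR nu / INR n))
  - PI / (12 * INR n) * csc (PI * INR nu / INR n) ^ 2
  + INR n * f_nu nu
  + 7 * PI ^ 3 / (21600 * INR n ^ 3).

(* Main.v *)
Require Import Defs.
From Stdlib Require Import Reals Factorial Lra Lia.
From Coquelicot Require Import Coquelicot.

(* With h = PI / (2 n), the product formula for sin((2k+1)t) sin t and the
   geometric sine sum give
     C_n(nu) = sum_{l=1}^n cot(l h) - 2 sum_{k=1}^nu cot((2k-1) h),
   so only the cotangent near 0 and the full cotangent sum have to be expanded.
   Both singular expansions are reduced to the tangent, which is smooth on
   [0, PI/4], by the duplication formula 2 cot x = cot(x/2) - tan(x/2): a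
   quantity whose change under x |-> x/2 is O(x^6) differs from its limit at 0
   by O(x^6).  For the full sum, this quantity is the Euler-Maclaurin defect of
   cot with step k; its change under k |-> k/2 is the Euler-Maclaurin error of
   tan, and its limit as k -> 0 is the corresponding defect of the harmonic sum,
   which is euler_gamma + O(n^-5). *)

(** * Taylor's formula with remainder *)

Fixpoint taylor_poly (c : nat -> R) (n : nat) (t : R) : R :=
  match n with
  | O => 0
  | S m => taylor_poly c m t + c m / INR (fact m) * t ^ m
  end.

Lemma is_derive_monomial (c : R) (k : nat) (t : R) :
  is_derive (fun s => c / INR (fact (S k)) * s ^ S k) t (c / INR (fact k) * t ^ k).
Proof.
  replace (c / INR (fact k)) with (c / INR (fact (S k)) * INR (S k)).
  - generalize (c / INR (fact (S k))); intros b.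
    auto_derive; auto.
    change (b * (1 * (INR (S k) * t ^ k)) = b * INR (S k) * t ^ k); ring.
  - rewrite fact_simpl, mult_INR.
    field; split; [apply INR_fact_neq_0 | apply not_0_INR; lia].
Qed.

Lemma taylor_poly_0 (c : nat -> R) (n : nat) : taylor_poly c (S n) 0 = c O.
Proof.
  induction n as [|n IH].
  - simpl; field.
  - change (taylor_poly c (S n) 0 + c (S n) / INR (fact (S n)) * 0 ^ S n = c O).
    rewrite IH, pow_i by lia; ring.
Qed.

(** The coefficients are stored as derivatives, with the factorials kept outside, so that
    differentiating only shifts the sequence [c]. *)
Lemma is_derive_taylor_poly (c : nat -> R) (n : nat) (t : R) :
  is_derive (taylor_poly c (S n)) t (taylor_poly (fun i => c (S i)) n t).
Proof.
  induction n as [|n IH].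
  - simpl; auto_derive; auto; ring.
  - change (is_derive (fun s => taylor_poly c (S n) s
              + c (S n) / INR (fact (S n)) * s ^ S n) t
             (taylor_poly (fun i => c (S i)) n t + c (S n) / INR (fact n) * t ^ n)).
    refine (is_derive_plus _ _ _ _ _ _ _); [exact IH|].
    apply is_derive_monomial.
Qed.

(** With [q] the claimed bound, [q - g] and [q + g] vanish at 0 and have nonnegative derivatives, so
    the mean value theorem makes both nonnegative. The sign [sg] treats the two cases at once. *)
Lemma Rabs_le_pow_of_derive (g dg : R -> R) (h M : R) (k : nat) :
  g 0 = 0 ->
  (forall t, 0 <= t <= h -> is_derive g t (dg t)) ->
  (forall t, 0 <= t <= h -> Rabs (dg t) <= M / INR (fact k) * t ^ k) ->
  forall t, 0 <= t <= h -> Rabs (g t) <= M / INR (fact (S k)) * t ^ S k.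
Proof.
  intros g0 Hd Hb t Ht.
  assert (Hq : forall s, is_derive (fun s => M / INR (fact (S k)) * s ^ S k) s
                           (M / INR (fact k) * s ^ k))
    by (intros s; apply is_derive_monomial).
  set (q := fun s => M / INR (fact (S k)) * s ^ S k) in *.
  set (dq := fun s => M / INR (fact k) * s ^ k) in *.
  assert (q0 : q 0 = 0) by (unfold q; rewrite pow_i by lia; ring).
  assert (Hmin : Rmin 0 t = 0) by (apply Rmin_left; lra).
  assert (Hmax : Rmax 0 t = t) by (apply Rmax_right; lra).
  assert (Hs : forall sg, sg = 1 \/ sg = -1 -> sg * g t <= q t).
  { intros sg Hsg.
    destruct (MVT_gen (fun s => q s - sg * g s) 0 t (fun s => dq s - sg * dg s))
      as [c [Hc E]].
    - rewrite Hmin, Hmax; intros x Hx.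
      refine (is_derive_minus _ _ _ _ _ _ _); [apply Hq|].
      refine (is_derive_scal _ _ _ _ _); apply Hd; lra.
    - rewrite Hmin, Hmax; intros x Hx.
      apply continuity_pt_filterlim, (ex_derive_continuous (fun s => q s - sg * g s)).
      exists (dq x - sg * dg x).
      refine (is_derive_minus _ _ _ _ _ _ _); [apply Hq|].
      refine (is_derive_scal _ _ _ _ _); apply Hd; lra.
    - rewrite Hmin, Hmax in Hc.
      assert (Hbc := Hb c ltac:(lra)).
      fold (dq c) in Hbc.
      apply Rabs_le_between in Hbc.
      assert (0 <= dq c - sg * dg c) by (destruct Hsg; subst sg; lra).
      rewrite q0, g0 in E.
      assert (0 <= (dq c - sg * dg c) * (t - 0)) by (apply Rmult_le_pos; lra).
      lra. }
  fold (q t); apply Rabs_le; split.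
  - generalize (Hs (-1) (or_intror eq_refl)); lra.
  - generalize (Hs 1 (or_introl eq_refl)); lra.
Qed.

(** The family [f] stands for a function with its successive derivatives. Differentiating the
    remainder of order [S n] of [f m] gives the remainder of order [n] of [f (S m)]; this is why [m]
    varies in the induction. *)
Lemma taylor_remainder (f : nat -> R -> R) (a h M : R) (n : nat) : forall m,
  (forall i x, (i < m + n)%nat -> a <= x <= a + h -> is_derive (f i) x (f (S i) x)) ->
  (forall x, a <= x <= a + h -> Rabs (f (m + n)%nat x) <= M) ->
  forall t, 0 <= t <= h ->
  Rabs (f m (a + t) - taylor_poly (fun i => f (m + i)%nat a) n t)
    <= M / INR (fact n) * t ^ n.
Proof.
  induction n as [|n IH]; intros m Hd Hb t Ht.
  - simpl. rewrite Rminus_0_r. replace (M / 1 * 1) with M by field.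
    rewrite <- (Nat.add_0_r m). apply Hb; lra.
  - apply (Rabs_le_pow_of_derive
             (fun s => f m (a + s) - taylor_poly (fun i => f (m + i)%nat a) (S n) s)
             (fun s => f (S m) (a + s) - taylor_poly (fun i => f (S m + i)%nat a) n s) h);
      auto.
    + rewrite taylor_poly_0, Nat.add_0_r, Rplus_0_r; ring.
    + intros s Hs.
      refine (is_derive_minus _ _ _ _ _ _ _).
      * replace (f (S m) (a + s)) with (1 * f (S m) (a + s)) by ring.
        refine (is_derive_comp (f m) (fun s => a + s) _ _ _ _ _).
        -- apply Hd; [lia | lra].
        -- auto_derive; auto.
      * replace (taylor_poly (fun i => f (S m + i)%nat a) n s)
          with (taylor_poly (fun i => f (m + S i)%nat a) n s).
        -- apply is_derive_taylor_poly.
        -- clear; induction n as [|n IH]; simpl; auto.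
           rewrite IH, Nat.add_succ_r; auto.
    + intros s Hs; apply IH; auto.
      * intros i x Hi; apply Hd; lia.
      * intros x Hx. replace (S m + n)%nat with (m + S n)%nat by lia. auto.
Qed.

(** * The Euler-Maclaurin formula with two correction terms *)

(** Here [f 0] is the antiderivative of the function [f 1] being summed. Expanding [f 0], [f 1],
    [f 2] and [f 4] at [a], all to total order 6, the weights 1, -h/2, h^2/12 and -h^4/720 make the
    Taylor polynomials cancel. *)
Lemma euler_maclaurin_step (f : nat -> R -> R) (a h M : R) :
  0 <= h ->
  (forall i x, (i < 6)%nat -> a <= x <= a + h -> is_derive (f i) x (f (S i) x)) ->
  (forall x, a <= x <= a + h -> Rabs (f 6%nat x) <= M) ->
  Rabs (f 0%nat (a + h) - f 0%nat a - h / 2 * (f 1%nat a + f 1%nat (a + h))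
        + h ^ 2 / 12 * (f 2%nat (a + h) - f 2%nat a)
        - h ^ 4 / 720 * (f 4%nat (a + h) - f 4%nat a)) <= M * h ^ 6.
Proof.
  intros Hh Hd Hb.
  assert (Hr : forall m n, (m + n = 6)%nat ->
    Rabs (f m (a + h) - taylor_poly (fun i => f (m + i)%nat a) n h)
      <= M / INR (fact n) * h ^ n).
  { intros m n E. apply (taylor_remainder f a h M); [|rewrite E; exact Hb|lra].
    intros i x Hi; apply Hd; lia. }
  assert (M0 : 0 <= M)
    by (eapply Rle_trans; [apply Rabs_pos | apply (Hb a); lra]).
  assert (P6 : 0 <= M * h ^ 6) by (apply Rmult_le_pos; [lra | apply pow_le; lra]).
  generalize (Hr 0%nat 6%nat eq_refl) (Hr 1%nat 5%nat eq_refl)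
    (Hr 2%nat 4%nat eq_refl) (Hr 4%nat 2%nat eq_refl); clear Hr.
  cbn [taylor_poly Nat.add].
  replace (INR (fact 0)) with 1 by (simpl; lra).
  replace (INR (fact 1)) with 1 by (simpl; lra).
  replace (INR (fact 2)) with 2 by (simpl; lra).
  replace (INR (fact 3)) with 6 by (simpl; lra).
  replace (INR (fact 4)) with 24 by (simpl; lra).
  replace (INR (fact 5)) with 120 by (simpl; lra).
  replace (INR (fact 6)) with 720 by (simpl; lra).
  set (e0 := f 0%nat (a + h) - _); set (e1 := f 1%nat (a + h) - _);
  set (e2 := f 2%nat (a + h) - _); set (e4 := f 4%nat (a + h) - _).
  intros H0 H1 H2 H4.
  assert (Hq : forall q e B, 0 <= q -> Rabs e <= B -> - (q * B) <= q * e <= q * B).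
  { intros q e B q0 He; apply Rabs_le_between in He; split; nra. }
  assert (h4 : 0 <= h ^ 4) by (apply pow_le; lra).
  generalize (Hq 1 e0 _ ltac:(lra) H0) (Hq (h / 2) e1 _ ltac:(lra) H1)
    (Hq (h ^ 2 / 12) e2 _ ltac:(nra) H2) (Hq (h ^ 4 / 720) e4 _ ltac:(lra) H4).
  intros Q0 Q1 Q2 Q4.
  match goal with |- Rabs ?x <= _ =>
    replace x with (1 * e0 - h / 2 * e1 + h ^ 2 / 12 * e2 - h ^ 4 / 720 * e4)
      by (unfold e0, e1, e2, e4; field) end.
  (* The four remainders add up to (1/720 + 1/240 + 1/288 + 1/1440) M h^6 = 7/720 M h^6, well below
     the bound. *)
  apply Rabs_le; split; lra.
Qed.

Lemma sum_1_S (u : nat -> R) (n : nat) :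
  (sum_n_m u 1 (S n) : R) = sum_n_m u 1 n + u (S n).
Proof. rewrite sum_n_Sm by lia; reflexivity. Qed.

Lemma sum_1_0 (u : nat -> R) : (sum_n_m u 1 0 : R) = 0.
Proof. rewrite sum_n_m_zero by lia; reflexivity. Qed.

(** The single steps telescope. The sum omits the left endpoint, so the trapezoidal weights appear
    as a right-hand sum corrected by h/2 times the difference of the end values. *)
Lemma euler_maclaurin (f : nat -> R -> R) (a h M : R) (n : nat) :
  0 <= h ->
  (forall i x, (i < 6)%nat -> a <= x <= a + INR n * h -> is_derive (f i) x (f (S i) x)) ->
  (forall x, a <= x <= a + INR n * h -> Rabs (f 6%nat x) <= M) ->
  Rabs (f 0%nat (a + INR n * h) - f 0%nat a
        - h * sum_n_m (fun l => f 1%nat (a + INR l * h)) 1 n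
        + h / 2 * (f 1%nat (a + INR n * h) - f 1%nat a)
        + h ^ 2 / 12 * (f 2%nat (a + INR n * h) - f 2%nat a)
        - h ^ 4 / 720 * (f 4%nat (a + INR n * h) - f 4%nat a)) <= INR n * (M * h ^ 6).
Proof.
  intros Hh; induction n as [|n IH]; intros Hd Hb.
  - rewrite sum_1_0. simpl INR. rewrite !Rmult_0_l, Rplus_0_r.
    match goal with |- Rabs ?x <= _ => replace x with 0 by ring end.
    rewrite Rabs_R0; lra.
  - assert (Hn : 0 <= INR n * h) by (apply Rmult_le_pos; [apply pos_INR | lra]).
    rewrite S_INR in Hd, Hb.
    assert (Hs := euler_maclaurin_step f (a + INR n * h) h M Hh).
    specialize (IH ltac:(intros; apply Hd; auto; lra) ltac:(intros; apply Hb; lra)).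
    specialize (Hs ltac:(intros; apply Hd; auto; lra) ltac:(intros; apply Hb; lra)).
    rewrite sum_1_S, S_INR.
    replace (a + (INR n + 1) * h) with (a + INR n * h + h) by ring.
    apply Rabs_le_between in IH; apply Rabs_le_between in Hs.
    apply Rabs_le; split; lra.
Qed.

(** * Iterated halving, and the derivatives of the tangent and the reciprocal *)

Lemma lim_halving_bound (u : nat -> R) (L B : R) :
  (forall j, Rabs (u j - u (S j)) <= B * (/ 2) ^ j) ->
  is_lim_seq u L -> Rabs (u O - L) <= 2 * B.
Proof.
  intros Hu HL.
  assert (Hj : forall j, Rabs (u O - u j) <= 2 * B * (1 - (/ 2) ^ j)).
  { induction j as [|j IH].
    - simpl; rewrite Rminus_diag, Rabs_R0; lra.
    - replace (u O - u (S j)) with ((u O - u j) + (u j - u (S j))) by ring.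
      eapply Rle_trans; [apply Rabs_triang|].
      specialize (Hu j); simpl; lra. }
  assert (B0 : 0 <= B)
    by (generalize (Hu O) (Rabs_pos (u O - u 1%nat)); simpl; lra).
  apply (is_lim_seq_le (fun j => Rabs (u O - u j)) (fun _ => 2 * B)
           (Rabs (u O - L)) (2 * B)).
  - intros j; eapply Rle_trans; [apply Hj|].
    assert (0 < (/ 2) ^ j) by (apply pow_lt; lra); nra.
  - apply (is_lim_seq_abs (fun j => u O - u j) (u O - L)).
    apply is_lim_seq_minus'; auto. apply is_lim_seq_const.
  - apply is_lim_seq_const.
Qed.

(* The antiderivative, then the function, then its first five derivatives. *)
Definition tan_jet (i : nat) (x : R) : R :=
  let t := tan x in
  match i with
  | 0 => - ln (cos x)
  | 1 => t
  | 2 => 1 + t ^ 2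
  | 3 => 2 * t + 2 * t ^ 3
  | 4 => 2 + 8 * t ^ 2 + 6 * t ^ 4
  | 5 => 16 * t + 40 * t ^ 3 + 24 * t ^ 5
  | _ => (16 + 120 * t ^ 2 + 120 * t ^ 4) * (1 + t ^ 2)
  end.

Definition inv_jet (i : nat) (x : R) : R :=
  match i with
  | 0 => ln x
  | 1 => / x
  | 2 => - / x ^ 2
  | 3 => 2 / x ^ 3
  | 4 => - 6 / x ^ 4
  | 5 => 24 / x ^ 5
  | _ => - 120 / x ^ 6
  end.

Lemma cos_pos_quarter (x : R) : 0 <= x <= PI / 4 -> 0 < cos x.
Proof. intros Hx; apply cos_gt_0; generalize PI_RGT_0; lra. Qed.

Lemma tan_jet_derive (i : nat) (x : R) : (i < 6)%nat -> 0 <= x <= PI / 4 ->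
  is_derive (tan_jet i) x (tan_jet (S i) x).
Proof.
  intros Hi Hx; assert (Hc := cos_pos_quarter x Hx).
  assert (Ht : is_derive tan x (tan x ^ 2 + 1)) by (apply is_derive_tan; lra).
  assert (Ht' : ex_derive tan x) by (eexists; exact Ht).
  apply is_derive_unique in Ht; change (Derive (fun y => tan y) x = tan x ^ 2 + 1) in Ht.
  destruct i as [|[|[|[|[|[|i]]]]]]; [..|lia]; unfold tan_jet; cbv zeta.
  { auto_derive; [auto|unfold tan; field; lra]. }
  all: auto_derive; auto; rewrite Ht; ring.
Qed.

Lemma tan_bounds_quarter (x : R) : 0 <= x <= PI / 4 -> 0 <= tan x <= 1.
Proof.
  intros Hx; assert (Hpi := PI_RGT_0); split.
  - destruct (Req_dec x 0) as [->|Hx0]; [rewrite tan_0; lra|].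
    left; apply tan_gt_0; lra.
  - rewrite <- tan_PI4.
    destruct (Req_dec x (PI / 4)) as [->|Hx4]; [lra|].
    left; apply tan_increasing; lra.
Qed.

(** As a polynomial in [tan x] with nonnegative coefficients, the sixth entry is largest at
    [tan x = 1], with value 256 * 2 = 512. *)
Lemma tan_jet_bound (x : R) : 0 <= x <= PI / 4 -> Rabs (tan_jet 6 x) <= 512.
Proof.
  intros Hx; assert (Ht := tan_bounds_quarter x Hx); unfold tan_jet.
  set (t := tan x) in *.
  assert (0 <= t ^ 2 <= 1) by (split; nra).
  replace (t ^ 4) with (t ^ 2 * t ^ 2) by ring.
  set (s := t ^ 2) in *.
  rewrite Rabs_pos_eq by nra; nra.
Qed.

Lemma inv_jet_derive (i : nat) (x : R) : (i < 6)%nat -> 0 < x ->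
  is_derive (inv_jet i) x (inv_jet (S i) x).
Proof.
  intros Hi Hx.
  assert (Hp : forall k, x ^ k <> 0) by (intros k; apply pow_nonzero; lra).
  destruct i as [|[|[|[|[|[|i]]]]]]; [..|lia]; unfold inv_jet; auto_derive.
  all: auto; try (field; lra).
  all: match goal with |- 0 < _ => idtac | |- _ <> 0 => idtac end.
  all: repeat apply Rmult_integral_contrapositive_currified; lra.
Qed.

(** * Expansions at 0 by the duplication formula *)

Definition cot (x : R) : R := cos x / sin x.

Lemma cot_half (x : R) : sin x <> 0 ->
  cot x = (cot (x / 2) - tan (x / 2)) / 2.
Proof.
  intros Hs. replace x with (2 * (x / 2)) in Hs |- * at 1 by field.
  set (y := x / 2) in *.
  unfold cot, tan; rewrite sin_2a in *; rewrite cos_2a.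
  assert (sin y <> 0) by (intros E; apply Hs; rewrite E; ring).
  assert (cos y <> 0) by (intros E; apply Hs; rewrite E; ring).
  field; auto.
Qed.

Lemma half_pow_bounds (j : nat) : 0 < (/ 2) ^ j <= 1.
Proof.
  split; [apply pow_lt; lra|].
  rewrite <- (pow1 j); apply pow_incr; lra.
Qed.

Lemma half_iter_bounds (x : R) (j : nat) : 0 < x -> 0 < x * (/ 2) ^ j <= x.
Proof.
  intros Hx; assert (0 < (/ 2) ^ j <= 1).
  { split; [apply pow_lt; lra|].
    rewrite <- (pow1 j); apply pow_incr; lra. }
  split; [apply Rmult_lt_0_compat|]; nra.
Qed.

Lemma is_lim_seq_half_iter (x : R) : is_lim_seq (fun j => x * (/ 2) ^ j) 0.
Proof.
  replace (Finite 0) with (Rbar_mult x 0) by (simpl; f_equal; ring).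
  apply is_lim_seq_scal_l, is_lim_seq_geom. rewrite Rabs_pos_eq; lra.
Qed.

(** Telescoping along x, x/2, x/4, ...: the increment at x/2^j is at most B x^6 / 2^(6j), and
    keeping only the factor 1/2^j already gives a geometric series with sum 2 B x^6. Only the limit
    along this sequence enters, so [g] may be singular at 0. *)
Lemma halving_bound (g : R -> R) (x L B : R) :
  0 < x -> 0 <= B ->
  (forall z, 0 < z <= x -> Rabs (g z - g (z / 2)) <= B * z ^ 6) ->
  is_lim_seq (fun j => g (x * (/ 2) ^ j)) L ->
  Rabs (g x - L) <= 2 * (B * x ^ 6).
Proof.
  intros Hx HB Hg HL.
  replace (g x) with (g (x * (/ 2) ^ 0)) by (f_equal; simpl; ring).
  apply (lim_halving_bound (fun j => g (x * (/ 2) ^ j))); auto.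
  intros j; assert (Hj := half_iter_bounds x j Hx).
  replace (x * (/ 2) ^ S j) with (x * (/ 2) ^ j / 2) by (simpl; field).
  eapply Rle_trans; [apply Hg; auto|].
  rewrite Rmult_assoc; apply Rmult_le_compat_l; auto.
  rewrite Rpow_mult_distr; apply Rmult_le_compat_l; [apply pow_le; lra|].
  assert (Hq := half_pow_bounds j).
  set (q := (/ 2) ^ j) in *. replace (q ^ 6) with (q * q ^ 5) by ring.
  assert (q ^ 5 <= 1) by (rewrite <- (pow1 5); apply pow_incr; lra). nra.
Qed.

Lemma is_lim_seq_ex_derive (g : R -> R) (u : nat -> R) (l : R) :
  ex_derive g l -> is_lim_seq u l -> is_lim_seq (fun j => g (u j)) (g l).
Proof.
  intros Hg; apply is_lim_seq_continuous.
  apply continuity_pt_filterlim, (ex_derive_continuous g); auto.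
Qed.

Lemma is_lim_seq_sinc (u : nat -> R) : (forall j, u j <> 0) -> is_lim_seq u 0 ->
  is_lim_seq (fun j => sin (u j) / u j) 1.
Proof.
  intros Hu L.
  apply (is_lim_comp_seq (fun x => sin x / x) u 0 1 is_lim_sinc_0); auto.
  exists O; intros j _ E; injection E; apply Hu.
Qed.

Lemma is_lim_seq_x_cot (u : nat -> R) : (forall j, u j <> 0) -> is_lim_seq u 0 ->
  is_lim_seq (fun j => u j * cot (u j)) 1.
Proof.
  intros Hu L.
  replace 1 with (cos 0 / 1) by (rewrite cos_0; field).
  apply is_lim_seq_ext with (fun j => cos (u j) / (sin (u j) / u j)).
  (* Where [sin (u j)] vanishes both sides are 0, as division by 0 yields 0. *)
  - intros j; unfold cot, Rdiv; rewrite Rinv_mult, Rinv_inv; ring.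
  - apply is_lim_seq_div'; [|apply is_lim_seq_sinc; auto|lra].
    apply is_lim_seq_continuous; auto. apply continuity_cos.
Qed.

(** Duplication gives z cot z = (z/2) cot(z/2) - (z/2) tan(z/2). The coefficients 1/3 and 1/45 are
    those for which the change of [g] under halving is -(z/2) times the remainder of tan(z/2) after
    its cubic term. The range up to PI/2 keeps z/2 in [0, PI/4]. *)
Lemma x_cot_bound (x : R) : 0 < x <= PI / 2 ->
  Rabs (x * cot x - (1 - x ^ 2 / 3 - x ^ 4 / 45)) <= x ^ 6.
Proof.
  intros Hx.
  set (g := fun y => y * cot y + y ^ 2 / 3 + y ^ 4 / 45).
  replace (x * cot x - _) with (g x - 1) by (unfold g; field).
  replace (x ^ 6) with (2 * (/ 2 * x ^ 6)) by field.
  apply halving_bound; [lra|lra|..].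
  - intros z Hz; unfold g.
    assert (Hs : sin z <> 0)
      by (apply Rgt_not_eq, sin_gt_0; generalize PI_RGT_0; lra).
    rewrite (cot_half z Hs).
    assert (T := taylor_remainder tan_jet 0 (z / 2) 512 5 1
      ltac:(intros; apply tan_jet_derive; [lia | lra])
      ltac:(intros; apply tan_jet_bound; lra) (z / 2) ltac:(lra)).
    unfold tan_jet in T; cbn [taylor_poly Nat.add fact Nat.mul] in T.
    rewrite Rplus_0_l, tan_0 in T.
    simpl INR in T.
    apply Rabs_le_between in T.
    assert (z5 : 0 < z ^ 5) by (apply pow_lt; lra).
    set (t := tan (z / 2)) in *.
    match goal with |- Rabs ?e <= _ =>
      replace e with (- (z / 2) * (t - (z / 2 + (z / 2) ^ 3 / 3))) by field end.
    rewrite Rabs_mult, Rabs_Ropp, (Rabs_pos_eq (z / 2)) by lra.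
    replace (/ 2 * z ^ 6) with (z / 2 * z ^ 5) by field.
    apply Rmult_le_compat_l; [lra|].
    apply Rabs_le; split; lra.
  - replace (Finite 1) with (Finite (1 + 0 ^ 2 / 3 + 0 ^ 4 / 45)) by (f_equal; field).
    assert (L := is_lim_seq_half_iter x).
    apply is_lim_seq_plus'; [apply is_lim_seq_plus'|].
    + apply is_lim_seq_x_cot; auto.
      intros j; generalize (half_iter_bounds x j ltac:(lra)); lra.
    + apply (is_lim_seq_ex_derive (fun y => y ^ 2 / 3)); auto; auto_derive; auto.
    + apply (is_lim_seq_ex_derive (fun y => y ^ 4 / 45)); auto; auto_derive; auto.
Qed.

(** The same halving scheme, now with sin z / z = sin(z/2)/(z/2) * cos(z/2): the change is governed
    by ln(cos(z/2)), which is minus entry 0 of [tan_jet]. *)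
Lemma ln_sinc_bound (x : R) : 0 < x <= PI / 2 ->
  Rabs (ln (sin x / x) + x ^ 2 / 6 + x ^ 4 / 180) <= x ^ 6.
Proof.
  intros Hx.
  set (g := fun y => ln (sin y / y) + y ^ 2 / 6 + y ^ 4 / 180).
  replace (ln (sin x / x) + _ + _) with (g x - 0) by (unfold g; field; lra).
  replace (x ^ 6) with (2 * (/ 2 * x ^ 6)) by field.
  apply halving_bound; [lra|lra|..].
  - intros z Hz; unfold g.
    assert (Hs : 0 < sin (z / 2))
      by (apply sin_gt_0; generalize PI_RGT_0; lra).
    assert (Hc := cos_pos_quarter (z / 2) ltac:(lra)).
    replace (sin z / z) with (sin (z / 2) / (z / 2) * cos (z / 2)).
    2: { replace z with (2 * (z / 2)) at 4 by field. rewrite sin_2a; field; lra. }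
    rewrite ln_mult; [|apply Rdiv_lt_0_compat; lra|lra].
    assert (T := taylor_remainder tan_jet 0 (z / 2) 512 6 0
      ltac:(intros; apply tan_jet_derive; [lia | lra])
      ltac:(intros; apply tan_jet_bound; lra) (z / 2) ltac:(lra)).
    unfold tan_jet in T; cbn [taylor_poly Nat.add fact Nat.mul] in T.
    rewrite Rplus_0_l, tan_0, cos_0, ln_1 in T.
    simpl INR in T.
    apply Rabs_le_between in T.
    assert (z5 : 0 < z ^ 6) by (apply pow_lt; lra).
    apply Rabs_le; split; lra.
  - replace (Finite 0) with (Finite (ln 1 + 0 ^ 2 / 6 + 0 ^ 4 / 180))
      by (rewrite ln_1; f_equal; field).
    assert (L := is_lim_seq_half_iter x).
    apply is_lim_seq_plus'; [apply is_lim_seq_plus'|].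
    + apply (is_lim_seq_ex_derive ln).
      * auto_derive; lra.
      * apply is_lim_seq_sinc; auto.
        intros j; generalize (half_iter_bounds x j ltac:(lra)); lra.
    + apply (is_lim_seq_ex_derive (fun y => y ^ 2 / 6)); auto; auto_derive; auto.
    + apply (is_lim_seq_ex_derive (fun y => y ^ 4 / 180)); auto; auto_derive; auto.
Qed.

(** * The Euler-Maclaurin defect of the full cotangent sum *)

(* The Euler-Maclaurin defect at [n] of the sum of [/ l] for [l <= n]. *)
Definition harm_em (n : nat) : R :=
  harm n - ln (INR n) - / INR n / 2 + (/ INR n) ^ 2 / 12 - (/ INR n) ^ 4 / 120.

(* [k] times the Euler-Maclaurin defect of the sum of [cot (l * k)], with the
   constants 2/3 and 28/15 chosen to make it invariant under halving [k] up to
   the error for [tan]. *)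
Definition cot_em (n : nat) (k : R) : R :=
  k * sum_n_m (fun l => cot (INR l * k)) 1 n
  - ln (sin (INR n * k) / k) - k / 2 * cot (INR n * k)
  + k ^ 2 / 12 * (cot (INR n * k) ^ 2 + 2 / 3)
  - k ^ 4 / 720 * (6 * cot (INR n * k) ^ 4 + 8 * cot (INR n * k) ^ 2 + 28 / 15).

Lemma sum_1_scal (a : R) (u : nat -> R) (n : nat) :
  (sum_n_m (fun l => a * u l) 1 n : R) = a * sum_n_m u 1 n.
Proof. exact (sum_n_m_mult_l (K := R_Ring) a u 1 n). Qed.

Lemma is_lim_seq_sum_1 (u : nat -> nat -> R) (l : nat -> R) (n : nat) :
  (forall i, (1 <= i <= n)%nat -> is_lim_seq (u i) (l i)) ->
  is_lim_seq (fun j => sum_n_m (fun i => u i j) 1 n) (sum_n_m l 1 n).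
Proof.
  induction n as [|n IH]; intros H.
  - rewrite sum_1_0. apply is_lim_seq_ext with (fun _ => 0).
    + intros j; rewrite sum_1_0; auto.
    + apply is_lim_seq_const.
  - rewrite sum_1_S.
    apply is_lim_seq_ext with (fun j => sum_n_m (fun i => u i j) 1 n + u (S n) j).
    + intros j; rewrite sum_1_S; auto.
    + apply is_lim_seq_plus'; [apply IH; intros; apply H; lia | apply H; lia].
Qed.

(** Each cotangent diverges as the step tends to 0, so powers of the step are distributed first: k
    cot(l k) tends to 1/l and sin(n k)/k to n. *)
Lemma is_lim_seq_cot_em (n : nat) (x : R) : (0 < n)%nat -> 0 < x ->
  is_lim_seq (fun j => cot_em n (x * (/ 2) ^ j)) (harm_em n).
Proof.
  intros Hn Hx.
  assert (Hk : forall j, x * (/ 2) ^ j <> 0)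
    by (intros j; generalize (half_iter_bounds x j Hx); lra).
  assert (L := is_lim_seq_half_iter x).
  set (k := fun j => x * (/ 2) ^ j) in *.
  change (is_lim_seq (fun j => cot_em n (k j)) (harm_em n)).
  assert (Hc : forall l, (0 < l)%nat ->
    is_lim_seq (fun j => k j * cot (INR l * k j)) (/ INR l)).
  { intros l Hl; assert (l0 : INR l <> 0) by (apply not_0_INR; lia).
    apply is_lim_seq_ext with (fun j => / INR l * (INR l * k j * cot (INR l * k j))).
    - intros j; field; auto.
    - replace (Finite (/ INR l)) with (Rbar_mult (/ INR l) 1) by (simpl; f_equal; ring).
      apply is_lim_seq_scal_l, (is_lim_seq_x_cot (fun j => INR l * k j)).
      + intros j; apply Rmult_integral_contrapositive_currified; auto; apply Hk.
      + replace (Finite 0) with (Rbar_mult (INR l) 0) by (simpl; f_equal; ring).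
        apply is_lim_seq_scal_l; auto. }
  assert (n0 : 0 < INR n) by (apply lt_0_INR; lia).
  assert (Hs : is_lim_seq (fun j => sin (INR n * k j) / k j) (INR n)).
  { apply is_lim_seq_ext with (fun j => INR n * (sin (INR n * k j) / (INR n * k j))).
    - intros j; field; split; [apply Hk | lra].
    - replace (Finite (INR n)) with (Rbar_mult (INR n) 1) by (simpl; f_equal; ring).
      apply is_lim_seq_scal_l, (is_lim_seq_sinc (fun j => INR n * k j)).
      + intros j; apply Rmult_integral_contrapositive_currified; [lra | apply Hk].
      + replace (Finite 0) with (Rbar_mult (INR n) 0) by (simpl; f_equal; ring).
        apply is_lim_seq_scal_l; auto. }
  assert (Hcn := Hc n Hn).
  set (c := fun j => k j * cot (INR n * k j)) in Hcn.
  (* The vanishing terms are the limits of the parts carrying a spare k^2; they are written out so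
     that the limit rules match summand by summand. *)
  replace (harm_em n) with
    (harm n - ln (INR n) - / INR n * / 2 + ((/ INR n) ^ 2 * / 12 + 0 * / 18)
     - ((/ INR n) ^ 4 * / 120 + 0 * (/ INR n * / INR n) * / 90 + 0 * 0 * (7 / 2700)))
    by (unfold harm_em; field; lra).
  assert (Hk2 : is_lim_seq (fun j => k j ^ 2) 0).
  { replace (Finite 0) with (Finite (0 ^ 2)) by (f_equal; ring).
    apply (is_lim_seq_ex_derive (fun y => y ^ 2)); auto; auto_derive; auto. }
  apply is_lim_seq_ext with (fun j =>
    sum_n_m (fun l => k j * cot (INR l * k j)) 1 n - ln (sin (INR n * k j) / k j)
    - c j * / 2 + (c j ^ 2 * / 12 + k j ^ 2 * / 18)
    - (c j ^ 4 * / 120 + k j ^ 2 * (c j * c j) * / 90 + k j ^ 2 * k j ^ 2 * (7 / 2700))).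
  - intros j; unfold cot_em, c. rewrite sum_1_scal; field.
  - repeat first [ apply is_lim_seq_minus' | apply is_lim_seq_plus'
                 | apply is_lim_seq_mult' | apply is_lim_seq_const ]; auto.
    + apply (is_lim_seq_sum_1 (fun l j => k j * cot (INR l * k j)) (fun l => / INR l)).
      intros l Hl; apply Hc; lia.
    + apply (is_lim_seq_ex_derive ln); auto; auto_derive; auto.
Qed.

Lemma angle_bounds (n l : nat) (k y : R) : (1 <= l <= n)%nat -> 0 < k -> INR n * k <= y ->
  0 < INR l * k <= y.
Proof.
  intros Hl Hk Hy.
  assert (0 < INR l) by (apply lt_0_INR; lia).
  assert (INR l <= INR n) by (apply le_INR; lia).
  split; nra.
Qed.

(** Duplication at every grid point, with sin 2y = 2 sin y cos y in the logarithm, turns the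
    difference into exactly the Euler-Maclaurin error of tan on [0, n k/2] with step k/2. This
    interval lies in [0, PI/4], and 512 (k/2)^6 = 8 k^6. *)
Lemma cot_em_half (n : nat) (k : R) : (0 < n)%nat -> 0 < k -> INR n * k <= PI / 2 ->
  Rabs (cot_em n k - cot_em n (k / 2)) <= 8 * INR n * k ^ 6.
Proof.
  intros Hn Hk Hy.
  assert (Hpi := PI_RGT_0).
  assert (E := euler_maclaurin tan_jet 0 (k / 2) 512 n ltac:(lra)
    ltac:(intros; apply tan_jet_derive; [lia | lra])
    ltac:(intros; apply tan_jet_bound; lra)).
  replace (8 * INR n * k ^ 6) with (INR n * (512 * (k / 2) ^ 6)) by field.
  match type of E with Rabs ?e <= _ => replace (cot_em n k - cot_em n (k / 2)) with e end;
    [exact E|]; clear E.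
  assert (Hsum : forall m, (m <= n)%nat ->
    k * sum_n_m (fun l => cot (INR l * k)) 1 m
    = k / 2 * (sum_n_m (fun l => cot (INR l * (k / 2))) 1 m
               - sum_n_m (fun l => tan (0 + INR l * (k / 2))) 1 m)).
  { induction m as [|m IH]; intros Hm.
    - rewrite !sum_1_0; ring.
    - rewrite !sum_1_S, Rmult_plus_distr_l, IH by lia.
      assert (Ha := angle_bounds n (S m) k _ ltac:(lia) Hk Hy).
      rewrite (cot_half (INR (S m) * k)) by (apply Rgt_not_eq, sin_gt_0; lra).
      rewrite Rplus_0_l. unfold Rdiv; rewrite <- !Rmult_assoc; field. }
  unfold cot_em; rewrite Hsum by lia; clear Hsum.
  assert (Ha := angle_bounds n n k _ ltac:(lia) Hk Hy).
  unfold tan_jet; cbv zeta; rewrite !Rplus_0_l, tan_0, cos_0, ln_1.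
  rewrite (cot_half (INR n * k)) by (apply Rgt_not_eq, sin_gt_0; lra).
  replace (INR n * (k / 2)) with (INR n * k / 2) by field.
  set (y := INR n * k / 2).
  replace (INR n * k) with (2 * y) by (unfold y; field).
  assert (0 < y <= PI / 4) by (unfold y; lra).
  assert (Hs : 0 < sin y) by (apply sin_gt_0; lra).
  assert (Hc := cos_pos_quarter y ltac:(lra)).
  replace (sin (2 * y) / k) with (sin y / (k / 2) * cos y) by (rewrite sin_2a; field; lra).
  rewrite ln_mult; [|apply Rdiv_lt_0_compat; lra|lra].
  rewrite (sum_n_m_ext (fun l => tan (0 + INR l * (k / 2))) (fun l => tan (INR l * (k / 2))))
    by (intros; rewrite Rplus_0_l; auto).
  (* With [tan y] as the inverse of [cot y], what remains is a rational identity in [cot y], the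
     sums and logarithms being atoms. *)
  assert (Ht : tan y = / cot y) by (unfold tan, cot; field; lra).
  assert (Hct : cot y <> 0) by (unfold cot; apply Rgt_not_eq, Rdiv_lt_0_compat; lra).
  rewrite Ht; field; auto.
Qed.

Lemma cot_em_bound (n : nat) (k : R) : (0 < n)%nat -> 0 < k -> INR n * k <= PI / 2 ->
  Rabs (cot_em n k - harm_em n) <= 16 * INR n * k ^ 6.
Proof.
  intros Hn Hk Hy.
  assert (Hn0 : 0 < INR n) by (apply lt_0_INR; lia).
  replace (16 * INR n * k ^ 6) with (2 * (8 * INR n * k ^ 6)) by ring.
  apply halving_bound; [lra|lra|..].
  - intros z Hz; apply cot_em_half; auto; [lra|nra].
  - apply is_lim_seq_cot_em; auto.
Qed.

(** * The harmonic defect and Euler's constant *)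

(** One Euler-Maclaurin step of length 1 for 1/x, up to sign; the last derivative, -120/x^6, is
    largest in absolute value at the left end. *)
Lemma harm_em_step (m : nat) : (0 < m)%nat ->
  Rabs (harm_em (S m) - harm_em m) <= 120 / INR m ^ 6.
Proof.
  intros Hm.
  assert (m0 : 0 < INR m) by (apply lt_0_INR; lia).
  assert (E := euler_maclaurin_step inv_jet (INR m) 1 (120 / INR m ^ 6) ltac:(lra)
    ltac:(intros; apply inv_jet_derive; [lia | lra])).
  rewrite !pow1, ?Rmult_1_r in E.
  match type of E with _ -> Rabs ?e <= _ => replace (harm_em (S m) - harm_em m) with (- e) end.
  - rewrite Rabs_Ropp; apply E.
    intros x Hx; unfold inv_jet.
    assert (0 < INR m ^ 6) by (apply pow_lt; auto).
    assert (INR m ^ 6 <= x ^ 6) by (apply pow_incr; lra).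
    unfold Rdiv; rewrite Rabs_mult, Rabs_inv, (Rabs_pos_eq (x ^ 6)) by lra.
    replace (Rabs (- 120)) with 120 by (rewrite Rabs_left; lra).
    apply Rmult_le_compat_l; [lra|]; apply Rinv_le_contravar; auto.
  - unfold harm_em, harm, inv_jet; rewrite sum_1_S, S_INR; field; lra.
Qed.

(** With j >= n, 120/j^6 = 240/j^4 * 1/(2 j^2) <= 240/n^4 * (1/j - 1/(j+1)), which telescopes. *)
Lemma harm_em_dist (n p : nat) : (0 < n)%nat ->
  Rabs (harm_em (n + p) - harm_em n) <= 240 / INR n ^ 4 * (/ INR n - / INR (n + p)).
Proof.
  intros Hn; assert (n0 : 0 < INR n) by (apply lt_0_INR; lia).
  induction p as [|p IH].
  - rewrite Nat.add_0_r, !Rminus_diag, Rabs_R0; lra.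
  - rewrite Nat.add_succ_r.
    assert (Hs := harm_em_step (n + p) ltac:(lia)).
    assert (Hj : INR n <= INR (n + p)) by (apply le_INR; lia).
    rewrite S_INR. set (j := INR (n + p)) in *.
    assert (j1 : 1 <= j) by (apply (le_INR 1); lia).
    replace (harm_em (S (n + p)) - harm_em n) with
      ((harm_em (S (n + p)) - harm_em (n + p)) + (harm_em (n + p) - harm_em n)) by ring.
    eapply Rle_trans; [apply Rabs_triang|].
    apply Rle_trans with (240 / INR n ^ 4 * (/ j - / (j + 1))
                          + 240 / INR n ^ 4 * (/ INR n - / j)); [|apply Req_le; ring].
    apply Rplus_le_compat; auto.
    eapply Rle_trans; [exact Hs|].
    assert (0 < INR n ^ 4) by (apply pow_lt; auto).
    assert (INR n ^ 4 <= j ^ 4) by (apply pow_incr; lra).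
    replace (120 / j ^ 6) with (240 * (/ j ^ 4) * (/ (2 * j ^ 2))) by (field; lra).
    unfold Rdiv; replace (/ j - / (j + 1)) with (/ (j * (j + 1))) by (field; lra).
    apply Rmult_le_compat.
    + apply Rmult_le_pos; [lra|]. apply Rlt_le, Rinv_0_lt_compat; lra.
    + apply Rlt_le, Rinv_0_lt_compat; nra.
    + apply Rmult_le_compat_l; [lra|]; apply Rinv_le_contravar; auto.
    + apply Rinv_le_contravar; nra.
Qed.

Lemma is_lim_seq_inv_INR_pow (k : nat) : is_lim_seq (fun n => (/ INR n) ^ S k) 0.
Proof.
  assert (L : is_lim_seq (fun n => / INR n) 0).
  { apply (is_lim_seq_inv _ p_infty); [apply is_lim_seq_INR | discriminate]. }
  replace (Finite 0) with (Finite (0 ^ S k)) by (f_equal; apply pow_i; lia).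
  apply (is_lim_seq_ex_derive (fun y => y ^ S k)); auto; auto_derive; auto.
Qed.

(** The telescoped estimate makes [harm_em] a Cauchy sequence. Its correction terms tend to 0, so
    its limit is that of H_n - ln n, which is thereby finite and equal to [euler_gamma]; letting p
    grow in the estimate gives the bound. *)
Lemma harm_em_bound (n : nat) : (0 < n)%nat ->
  Rabs (harm_em n - euler_gamma) <= 240 / INR n ^ 5.
Proof.
  assert (Hd : forall n p, (0 < n)%nat -> Rabs (harm_em (n + p) - harm_em n) <= 240 / INR n ^ 5).
  { intros m p Hm; eapply Rle_trans; [apply harm_em_dist; auto|].
    assert (m0 : 0 < INR m) by (apply lt_0_INR; lia).
    assert (0 < / INR (m + p)) by (apply Rinv_0_lt_compat, lt_0_INR; lia).
    replace (240 / INR m ^ 5) with (240 / INR m ^ 4 * / INR m) by (field; lra).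
    apply Rmult_le_compat_l; [|lra].
    apply Rlt_le, Rdiv_lt_0_compat; [lra | apply pow_lt; auto]. }
  assert (L0 : is_lim_seq (fun n => 240 * (/ INR n) ^ 5) 0).
  { replace (Finite 0) with (Rbar_mult 240 0) by (simpl; f_equal; ring).
    apply is_lim_seq_scal_l, is_lim_seq_inv_INR_pow. }
  assert (Hex : ex_finite_lim_seq harm_em).
  { apply ex_lim_seq_cauchy_corr; intros eps.
    apply is_lim_seq_spec in L0.
    destruct (L0 (pos_div_2 eps)) as [N HN].
    (* The reference index is [S N] and not [N], since [Hd] needs it positive. *)
    assert (Hb : forall m, (S N <= m)%nat -> Rabs (harm_em m - harm_em (S N)) < eps / 2).
    { intros m Hm; replace m with (S N + (m - S N))%nat by lia.
      eapply Rle_lt_trans; [apply Hd; lia|].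
      specialize (HN (S N) ltac:(lia)); simpl pos in HN.
      rewrite Rminus_0_r, pow_inv in HN.
      eapply Rle_lt_trans; [apply Rle_abs | exact HN]. }
    exists (S N); intros m p Hm Hp.
    replace (harm_em m - harm_em p) with
      ((harm_em m - harm_em (S N)) + - (harm_em p - harm_em (S N))) by ring.
    eapply Rle_lt_trans; [apply Rabs_triang|]; rewrite Rabs_Ropp.
    generalize (Hb m Hm) (Hb p Hp); lra. }
  destruct Hex as [g Hg].
  assert (Eg : euler_gamma = g).
  { unfold euler_gamma.
    rewrite (is_lim_seq_unique (fun m => harm m - ln (INR m)) g); auto.
    apply is_lim_seq_ext with (fun m => harm_em m + ((/ INR m) ^ 1 * / 2 - (/ INR m) ^ 2 * / 12
                                        + (/ INR m) ^ 4 * / 120)).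
    - intros m; unfold harm_em; generalize (/ INR m); intros r; field.
    - replace g with (g + (0 * / 2 - 0 * / 12 + 0 * / 120)) by ring.
      repeat first [ apply is_lim_seq_minus' | apply is_lim_seq_plus'
                 | apply is_lim_seq_mult' | apply is_lim_seq_const
                 | apply is_lim_seq_inv_INR_pow ]; auto. }
  intros Hn; rewrite Eg, Rabs_minus_sym.
  apply (is_lim_seq_le (fun p => Rabs (harm_em (n + p) - harm_em n)) (fun _ => 240 / INR n ^ 5)
           (Rabs (g - harm_em n)) (240 / INR n ^ 5)).
  - intros p; apply Hd; auto.
  - apply (is_lim_seq_abs (fun p => harm_em (n + p) - harm_em n) (g - harm_em n)).
    apply is_lim_seq_minus'; [|apply is_lim_seq_const].
    apply is_lim_seq_ext with (fun p => harm_em (p + n)).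
    + intros p; f_equal; lia.
    + apply is_lim_seq_incr_n; auto.
  - apply is_lim_seq_const.
Qed.

(** * Exact reduction of the sum to cotangent sums *)

Lemma sum_1_ext (u v : nat -> R) (n : nat) :
  (forall l, (1 <= l <= n)%nat -> u l = v l) -> (sum_n_m u 1 n : R) = sum_n_m v 1 n.
Proof. apply sum_n_m_ext_loc. Qed.

Lemma sum_1_minus (u v : nat -> R) (n : nat) :
  (sum_n_m (fun l => u l - v l) 1 n : R) = sum_n_m u 1 n - sum_n_m v 1 n.
Proof.
  induction n as [|n IH]; [rewrite !sum_1_0; ring|].
  rewrite !sum_1_S, IH; ring.
Qed.

Lemma sum_1_rev (u : nat -> R) (n : nat) :
  sum_n_m (fun l => u (S n - l)%nat) 1 n = sum_n_m u 1 n.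
Proof.
  induction n as [|n IH]; [rewrite !sum_1_0; auto|].
  rewrite sum_Sn_m, <- sum_n_m_S, sum_1_S by lia.
  rewrite (sum_1_ext _ (fun l => u (S n - l)%nat)) by (intros; f_equal; lia).
  rewrite IH; simpl; apply Rplus_comm.
Qed.

Lemma cot_PI_minus (x : R) : cot (PI - x) = - cot x.
Proof.
  unfold cot; rewrite sin_minus, cos_minus, sin_PI, cos_PI.
  replace (0 * cos x - -1 * sin x) with (sin x) by ring.
  unfold Rdiv; ring.
Qed.

(** The reflection of [l] to [S n - l] changes the sign of every term. *)
Lemma sum_cot_0 (n : nat) : (sum_n_m (fun l => cot (PI * INR l / INR (S n))) 1 n : R) = 0.
Proof.
  set (s := sum_n_m _ 1 n).
  assert (E : (s : R) = - s); [|lra].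
  unfold s at 1; rewrite <- sum_1_rev.
  rewrite (sum_1_ext _ (fun l => (-1) * cot (PI * INR l / INR (S n)))).
  - rewrite sum_1_scal; fold s; ring.
  - intros l Hl.
    replace (PI * INR (S n - l) / INR (S n)) with (PI - PI * INR l / INR (S n)).
    + rewrite cot_PI_minus; ring.
    + rewrite minus_INR by lia; field; apply not_0_INR; lia.
Qed.

Lemma csc_cot_half (x : R) : sin x <> 0 -> csc x = cot (x / 2) - cot x.
Proof.
  intros Hs. replace x with (2 * (x / 2)) in Hs |- * at 1 3 by field.
  set (y := x / 2) in *.
  unfold csc, cot; rewrite sin_2a in *; rewrite cos_2a_cos.
  assert (sin y <> 0) by (intros E; apply Hs; rewrite E; ring).
  assert (cos y <> 0) by (intros E; apply Hs; rewrite E; ring).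
  field; auto.
Qed.

Lemma sin_grid_pos (n l : nat) : (1 <= l < n)%nat -> 0 < sin (PI * INR l / INR n).
Proof.
  intros Hl; assert (Hpi := PI_RGT_0).
  assert (0 < INR l) by (apply lt_0_INR; lia).
  assert (INR l < INR n) by (apply lt_INR; lia).
  assert (0 < INR l / INR n) by (apply Rdiv_lt_0_compat; lra).
  assert (INR l / INR n < 1) by (apply (Rdiv_lt_1 (INR l)); lra).
  replace (PI * INR l / INR n) with (PI * (INR l / INR n)) by (field; lra).
  apply sin_gt_0; nra.
Qed.

(** From csc x = cot(x/2) - cot x, where the second part sums to 0. The term l = n is cot(PI/2) = 0;
    including it gives the grid ending at PI/2 that [cot_em] uses. *)
Lemma cos_csc_sum_0 (n : nat) : (0 < n)%nat ->
  cos_csc_sum n 0 = sum_n_m (fun l => cot (INR l * (PI / (2 * INR n)))) 1 n.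
Proof.
  destruct n as [|n]; [lia|]; intros _.
  assert (n0 : INR (S n) <> 0) by (apply not_0_INR; lia).
  unfold cos_csc_sum; rewrite sum_1_S, Nat.sub_succ, Nat.sub_0_r.
  replace (INR (S n) * (PI / (2 * INR (S n)))) with (PI / 2) by (field; auto).
  replace (cot (PI / 2)) with 0 by (unfold cot; rewrite cos_PI2; field; rewrite sin_PI2; lra).
  rewrite Rplus_0_r.
  rewrite (sum_1_ext _ (fun l => cot (INR l * (PI / (2 * INR (S n)))) - cot (PI * INR l / INR (S n)))).
  - rewrite sum_1_minus, sum_cot_0; ring.
  - intros l Hl; change (INR 0) with 0.
    replace (2 * PI * 0 * INR l / INR (S n)) with 0 by (field; auto).
    rewrite cos_0, Rmult_1_l.
    rewrite csc_cot_half by (apply Rgt_not_eq, sin_grid_pos; lia).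
    do 2 f_equal; field; auto.
Qed.

Lemma sum_sin (a : R) (m : nat) :
  2 * sin (a / 2) * sum_n_m (fun l => sin (INR l * a)) 1 m
  = cos (a / 2) - cos (INR m * a + a / 2).
Proof.
  induction m as [|m IH].
  - rewrite sum_1_0; simpl; rewrite Rmult_0_l, Rplus_0_l; ring.
  - rewrite sum_1_S, Rmult_plus_distr_l, IH, S_INR.
    set (b := (INR m + 1) * a).
    replace (INR m * a + a / 2) with (b - a / 2) by (unfold b; field).
    rewrite cos_minus, cos_plus; ring.
Qed.

(** With a = (2 nu + 1) PI / n the last angle of [sum_sin] is (2 nu + 1) PI - a/2, whose cosine is
    -cos(a/2). The hypothesis places a/2 in (0, PI), so sin(a/2) can be cancelled. *)
Lemma sum_sin_odd (n nu : nat) : (2 * nu + 1 < 2 * n)%nat ->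
  sum_n_m (fun l => sin ((2 * INR nu + 1) * (PI * INR l / INR n))) 1 (n - 1)
  = cot ((2 * INR nu + 1) * (PI / (2 * INR n))).
Proof.
  intros Hn; assert (Hpi := PI_RGT_0).
  assert (n0 : 0 < INR n) by (apply lt_0_INR; lia).
  set (a := (2 * INR nu + 1) * (PI / INR n)).
  rewrite (sum_1_ext _ (fun l => sin (INR l * a))).
  2: { intros l _; f_equal; unfold a; field; lra. }
  replace ((2 * INR nu + 1) * (PI / (2 * INR n))) with (a / 2) by (unfold a; field; lra).
  assert (E := sum_sin a (n - 1)).
  rewrite minus_INR in E by lia; change (INR 1) with 1 in E.
  replace ((INR n - 1) * a + a / 2) with (PI - a / 2 + 2 * INR nu * PI) in E
    by (unfold a; field; lra).
  rewrite cos_period, cos_minus, cos_PI, sin_PI in E.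
  assert (Hs : 0 < sin (a / 2)).
  { assert (2 * INR nu + 1 < 2 * INR n).
    { apply lt_INR in Hn; rewrite plus_INR, !mult_INR in Hn; simpl in Hn; lra. }
    assert (0 <= INR nu) by apply pos_INR.
    assert (0 < (2 * INR nu + 1) / (2 * INR n)) by (apply Rdiv_lt_0_compat; lra).
    assert ((2 * INR nu + 1) / (2 * INR n) < 1) by (apply (Rdiv_lt_1 (2 * INR nu + 1)); lra).
    replace (a / 2) with (PI * ((2 * INR nu + 1) / (2 * INR n))) by (unfold a; field; lra).
    apply sin_gt_0; nra. }
  unfold cot; apply (Rmult_eq_reg_l (2 * sin (a / 2))); [|lra].
  rewrite E; field; lra.
Qed.

(** Termwise, cos((2 nu + 2) t) - cos(2 nu t) = -2 sin((2 nu + 1) t) sin t, and csc t removes sin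
    t. *)
Lemma cos_csc_sum_S (n nu : nat) : (2 * nu + 1 < 2 * n)%nat ->
  cos_csc_sum n (S nu)
  = cos_csc_sum n nu - 2 * cot ((2 * INR nu + 1) * (PI / (2 * INR n))).
Proof.
  intros Hn; assert (n0 : INR n <> 0) by (apply not_0_INR; lia).
  rewrite <- sum_sin_odd, <- sum_1_scal by auto.
  unfold cos_csc_sum; rewrite <- sum_1_minus; apply sum_1_ext; intros l Hl.
  rewrite S_INR.
  assert (Hs := sin_grid_pos n l ltac:(lia)).
  set (t := PI * INR l / INR n) in *.
  replace (2 * PI * (INR nu + 1) * INR l / INR n) with ((2 * INR nu + 1) * t + t)
    by (unfold t; field; auto).
  replace (2 * PI * INR nu * INR l / INR n) with ((2 * INR nu + 1) * t - t)
    by (unfold t; field; auto).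
  rewrite cos_plus, cos_minus; unfold csc; field; lra.
Qed.

Lemma cos_csc_sum_cot (n nu : nat) : (0 < n)%nat -> (nu <= n)%nat ->
  cos_csc_sum n nu
  = sum_n_m (fun l => cot (INR l * (PI / (2 * INR n)))) 1 n
    - 2 * sum_n_m (fun k => cot ((2 * INR k - 1) * (PI / (2 * INR n)))) 1 nu.
Proof.
  intros Hn; induction nu as [|nu IH]; intros Hnu.
  - rewrite sum_1_0, cos_csc_sum_0, Rmult_0_r, Rminus_0_r by auto; reflexivity.
  - rewrite cos_csc_sum_S, IH, sum_1_S, S_INR by lia.
    replace (2 * (INR nu + 1) - 1) with (2 * INR nu + 1) by ring; ring.
Qed.

(** * Expansion of the odd cotangent sum and final assembly *)

(** Apply [x_cot_bound] to each a h with a = 2k - 1, and sum over k: the sums of 1/a, a and a^3 are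
    H_{2 nu} - H_nu / 2, nu^2 and nu^2 (2 nu^2 - 1). *)
Lemma sum_odd_cot_bound (nu : nat) (h : R) : 0 < h -> 2 * INR nu * h <= PI / 2 ->
  Rabs (h * sum_n_m (fun k => cot ((2 * INR k - 1) * h)) 1 nu
        - (harm (2 * nu) - harm nu / 2 - h ^ 2 * INR nu ^ 2 / 3
           - h ^ 4 * (INR nu ^ 2 * (2 * INR nu ^ 2 - 1)) / 45))
    <= INR nu * (2 * INR nu * h) ^ 6.
Proof.
  intros Hh Hy.
  assert (H : forall m, (m <= nu)%nat ->
    Rabs (h * sum_n_m (fun k => cot ((2 * INR k - 1) * h)) 1 m
        - (harm (2 * m) - harm m / 2 - h ^ 2 * INR m ^ 2 / 3
           - h ^ 4 * (INR m ^ 2 * (2 * INR m ^ 2 - 1)) / 45))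
    <= INR m * (2 * INR nu * h) ^ 6); [|apply H; auto].
  induction m as [|m IH]; intros Hm.
  - unfold harm; rewrite Nat.mul_0_r, !sum_1_0; simpl INR.
    match goal with |- Rabs ?x <= _ => replace x with 0 by field end.
    rewrite Rabs_R0; lra.
  - specialize (IH ltac:(lia)).
    assert (Hm' : INR m + 1 <= INR nu) by (rewrite <- S_INR; apply le_INR; lia).
    assert (m0 := pos_INR m).
    replace (2 * S m)%nat with (S (S (2 * m))) by lia.
    unfold harm in *; rewrite !sum_1_S, Rmult_plus_distr_l.
    rewrite !S_INR, mult_INR; change (INR 2) with 2.
    set (a := 2 * INR m + 1).
    replace (2 * (INR m + 1) - 1) with a by (unfold a; ring).
    assert (a1 : 1 <= a) by (unfold a; lra).
    assert (Ha : 0 < a * h <= 2 * INR nu * h) by (unfold a; split; nra).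
    assert (B := x_cot_bound (a * h) ltac:(lra)).
    assert (Hp : (a * h) ^ 6 <= (2 * INR nu * h) ^ 6) by (apply pow_incr; lra).
    assert (B' : Rabs (h * cot (a * h) - (/ a - a * h ^ 2 / 3 - a ^ 3 * h ^ 4 / 45))
                 <= (2 * INR nu * h) ^ 6).
    { eapply Rle_trans; [|exact Hp].
      replace (h * cot (a * h) - (/ a - a * h ^ 2 / 3 - a ^ 3 * h ^ 4 / 45))
        with (/ a * (a * h * cot (a * h) - (1 - (a * h) ^ 2 / 3 - (a * h) ^ 4 / 45)))
        by (field; lra).
      rewrite Rabs_mult, Rabs_pos_eq by (apply Rlt_le, Rinv_0_lt_compat; lra).
      rewrite <- (Rmult_1_l ((a * h) ^ 6)).
      apply Rmult_le_compat; auto using Rabs_pos.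
      - apply Rlt_le, Rinv_0_lt_compat; lra.
      - rewrite <- Rinv_1; apply Rinv_le_contravar; lra. }
    eapply Rle_trans; [|apply Req_le; symmetry; apply Rmult_plus_distr_r].
    rewrite Rmult_1_l.
    eapply Rle_trans; [|apply Rplus_le_compat; [exact IH | exact B']].
    eapply Rle_trans; [|apply Rabs_triang].
    apply Req_le; f_equal.
    set (hc := h * cot (a * h)). unfold a. field; lra.
Qed.

(** Needed for csc^2 = 1 + cot^2. If v = p + r with p the polynomial of [x_cot_bound], then v^2 -
    p^2 = r (r + 2 p), and p^2 agrees with the stated polynomial up to order x^6. *)
Lemma x_cot_sq_bound (x : R) : 0 < x <= 1 ->
  Rabs ((x * cot x) ^ 2 - (1 - 2 * x ^ 2 / 3 + x ^ 4 / 15)) <= 4 * x ^ 6.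
Proof.
  intros Hx.
  assert (B := x_cot_bound x ltac:(generalize PI2_1; lra)).
  set (v := x * cot x) in *.
  assert (Hv : 0 <= x ^ 2 <= 1) by (split; nra).
  replace (x ^ 4) with (x ^ 2 * x ^ 2) in * by ring.
  replace (x ^ 6) with (x ^ 2 * x ^ 2 * x ^ 2) in * by ring.
  set (s := x ^ 2) in *.
  set (r := v - (1 - s / 3 - s * s / 45)) in *.
  replace (v ^ 2 - _) with (r * (r + 2 * (1 - s / 3 - s * s / 45)) + s * s * s * (2 / 135 + s / 2025))
    by (unfold r; field).
  assert (s3 : 0 <= s * s * s <= 1) by (split; nra).
  assert (Hr : Rabs (r + 2 * (1 - s / 3 - s * s / 45)) <= 3).
  { apply Rabs_le_between in B; apply Rabs_le; split; nra. }
  eapply Rle_trans; [apply Rabs_triang|].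
  rewrite Rabs_mult, (Rabs_pos_eq (s * s * s * _)) by nra.
  assert (Rabs r * Rabs (r + 2 * (1 - s / 3 - s * s / 45)) <= s * s * s * 3)
    by (apply Rmult_le_compat; auto using Rabs_pos).
  nra.
Qed.

Lemma cos_csc_approx_bound (nu : nat) : (0 < nu)%nat -> exists K, forall n, (4 * nu <= n)%nat ->
  Rabs (cos_csc_sum n nu - cos_csc_approx n nu) <= K * (/ INR n) ^ 4.
Proof.
  intros Hnu.
  set (v := INR nu).
  assert (v1 : 1 <= v) by (apply (le_INR 1); lia).
  (* The contributions are 32 from the full cotangent sum, 240 from the harmonic defect, and (2 v +
     2) x^6 from the odd sum (2 v), csc^2 (1) and the logarithm (1). The factor 16 is 2^4, from h <=
     2/n. *)
  set (K0 := 32 + 240 + (2 * v + 2) * (2 * v) ^ 6).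
  exists (16 * K0); intros n Hn.
  assert (Hpi := PI_RGT_0). assert (Hpi4 := PI_4). assert (Hpi2 := PI2_1).
  assert (n0 : 0 < INR n) by (apply lt_0_INR; lia).
  assert (Hnv : 4 * v <= INR n)
    by (apply le_INR in Hn; rewrite mult_INR in Hn; simpl in Hn; unfold v; lra).
  set (h := PI / (2 * INR n)).
  assert (h0 : 0 < h) by (apply Rdiv_lt_0_compat; lra).
  assert (En : INR n = PI / (2 * h)) by (unfold h; field; lra).
  assert (Hnh : INR n * h = PI / 2) by (unfold h; field; lra).
  set (x := 2 * v * h).
  assert (x0 : 0 < x) by (unfold x; nra).
  assert (x1 : x <= 1) by (unfold x; nra).
  assert (B1 := cot_em_bound n h ltac:(lia) h0 ltac:(lra)).
  assert (B2 := harm_em_bound n ltac:(lia)).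
  assert (B3 := sum_odd_cot_bound nu h h0 ltac:(fold v; fold x; lra)).
  assert (B4 := x_cot_sq_bound x ltac:(lra)).
  assert (B5 := ln_sinc_bound x ltac:(lra)).
  fold v x in B3.
  unfold cot_em in B1. rewrite Hnh, sin_PI2 in B1.
  replace (cot (PI / 2)) with 0 in B1 by (unfold cot; rewrite cos_PI2, sin_PI2; field).
  assert (Hsx : 0 < sin x) by (apply sin_gt_0; lra).
  rewrite cos_csc_sum_cot by lia; fold h.
  set (S1 := sum_n_m _ 1 n) in *; set (S2 := sum_n_m _ 1 nu) in *.
  assert (Eln1 : ln (1 / h) = - ln h) by (unfold Rdiv; rewrite Rmult_1_l, ln_Rinv; auto).
  assert (Eln2 : ln (2 * sin x) = 2 * ln 2 + ln v + ln h + ln (sin x / x)).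
  { replace (2 * sin x) with (2 * (2 * v * h * (sin x / x))) by (unfold x; field; split; lra).
    rewrite !ln_mult; try lra; try nra.
    - apply Rdiv_lt_0_compat; lra.
    - apply Rmult_lt_0_compat; [nra | apply Rdiv_lt_0_compat; lra]. }
  assert (Ecsc : csc x ^ 2 = 1 + (x * cot x) ^ 2 / (4 * v ^ 2 * h ^ 2)).
  { unfold csc, cot, x in *; generalize (sin2_cos2 (2 * v * h)); unfold Rsqr; intros E.
    set (s := sin _) in *; set (c := cos _) in *.
    replace (/ s) with (1 / s) by (field; lra).
    field_simplify; [|lra|lra]. rewrite <- E. field; lra. }
  rewrite Eln1 in B1.
  unfold cos_csc_approx, f_nu; fold v.
  replace (PI * v / INR n) with x by (unfold x, h; field; lra).
  rewrite Eln2, Ecsc, En.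
  set (G := harm_em n) in *.
  set (L := ln (sin x / x)) in *; set (Q := (x * cot x) ^ 2) in *.
  set (D := _ - _ - _).
  (* All main terms cancel, leaving five error terms of order h^5. In particular h^4/720 * 28/15 = 7
     h^4/2700 is h times 7 PI^3/(21600 n^3), and the 1/(12 nu^2) in [f_nu] cancels the pole of
     csc^2. *)
  assert (ED : h * D =
     ((h * S1 - - ln h - h / 2 * 0 + h ^ 2 / 12 * (0 ^ 2 + 2 / 3)
        - h ^ 4 / 720 * (6 * 0 ^ 4 + 8 * 0 ^ 2 + 28 / 15)) - G)
     + (G - euler_gamma)
     - 2 * (h * S2 - (harm (2 * nu) - harm nu / 2 - h ^ 2 * v ^ 2 / 3
           - h ^ 4 * (v ^ 2 * (2 * v ^ 2 - 1)) / 45))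
     + / (24 * v ^ 2) * (Q - (1 - 2 * x ^ 2 / 3 + x ^ 4 / 15))
     + (L + x ^ 2 / 6 + x ^ 4 / 180)).
  { unfold D, x; field; lra. }
  assert (hx : h <= 1) by (unfold x in x1; nra).
  assert (hn : h <= 2 * / INR n).
  { unfold h; replace (PI / (2 * INR n)) with (PI / 2 * / INR n) by (field; lra).
    apply Rmult_le_compat_r; [apply Rlt_le, Rinv_0_lt_compat; lra | lra]. }
  assert (nh : / INR n <= h).
  { unfold h; replace (PI / (2 * INR n)) with (PI / 2 * / INR n) by (field; lra).
    rewrite <- (Rmult_1_l (/ INR n)) at 1.
    apply Rmult_le_compat_r; [apply Rlt_le, Rinv_0_lt_compat; lra | lra]. }
  assert (in0 : 0 < / INR n) by (apply Rinv_0_lt_compat; lra).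
  assert (h5 : 0 < h ^ 5) by (apply pow_lt; lra).
  assert (C1 : 16 * INR n * h ^ 6 <= 32 * h ^ 5).
  { replace (16 * INR n * h ^ 6) with (16 * (INR n * h) * h ^ 5) by ring.
    rewrite Hnh; nra. }
  assert (C2 : 240 / INR n ^ 5 <= 240 * h ^ 5).
  { unfold Rdiv; rewrite <- pow_inv.
    apply Rmult_le_compat_l; [lra | apply pow_incr; lra]. }
  assert (C3 : x ^ 6 <= (2 * v) ^ 6 * h ^ 5).
  { unfold x; rewrite Rpow_mult_distr; apply Rmult_le_compat_l; [apply pow_le; lra|].
    replace (h ^ 6) with (h * h ^ 5) by ring; nra. }
  assert (x6 : 0 < x ^ 6) by (apply pow_lt; lra).
  assert (Hq : 0 < / (24 * v ^ 2) <= / 24).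
  { split; [apply Rinv_0_lt_compat; nra | apply Rinv_le_contravar; nra]. }
  assert (B6 : h * Rabs D <= K0 * h ^ 5).
  { rewrite <- (Rabs_pos_eq h) at 1 by lra.
    rewrite <- Rabs_mult, ED.
    set (e1 := _ - G) in *; set (e2 := G - _) in *; set (e3 := h * S2 - _) in *;
    set (e4 := Q - _) in *; set (e5 := L + _ + _) in *.
    apply Rabs_le_between in B1; apply Rabs_le_between in B2; apply Rabs_le_between in B3;
    apply Rabs_le_between in B4; apply Rabs_le_between in B5.
    assert (B4' : - x ^ 6 <= / (24 * v ^ 2) * e4 <= x ^ 6) by (split; nra).
    assert (C4 : (2 * v + 2) * x ^ 6 <= (2 * v + 2) * ((2 * v) ^ 6 * h ^ 5))
      by (apply Rmult_le_compat_l; lra).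
    unfold K0; apply Rabs_le; split; nra. }
  assert (B7 : Rabs D <= K0 * h ^ 4).
  { apply (Rmult_le_reg_l h); auto.
    replace (h * (K0 * h ^ 4)) with (K0 * h ^ 5) by ring; auto. }
  eapply Rle_trans; [exact B7|]; rewrite <- En.
  replace (16 * K0 * (/ INR n) ^ 4) with (K0 * (2 * / INR n) ^ 4) by ring.
  apply Rmult_le_compat_l; [|apply pow_incr; lra].
  assert (0 <= (2 * v) ^ 6) by (apply pow_le; lra).
  unfold K0; nra.
Qed.

(* [is_domin eventually g h] is Coquelicot's  h = o(g)  as n -> oo. *)
Theorem theorem7 (nu : nat) (hnu : (1 < nu)%nat) :
  is_domin eventually (fun n : nat => / INR n ^ 3)
    (fun n : nat => cos_csc_sum n nu - cos_csc_approx n nu)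
  /\ is_lim_seq (fun n : nat => cos_csc_sum n nu - cos_csc_approx n nu) 0.
Proof.
  destruct (cos_csc_approx_bound nu ltac:(lia)) as [K HK].
  assert (L : forall k, is_lim_seq (fun n => K * (/ INR n) ^ S k) 0).
  { intros k; replace (Finite 0) with (Rbar_mult K 0) by (simpl; f_equal; ring).
    apply is_lim_seq_scal_l, is_lim_seq_inv_INR_pow. }
  split.
  - intros eps.
    (* Of the bound K/n^4, the factor K/n is what falls below [eps]. *)
    assert (L1 := L O); apply is_lim_seq_spec in L1.
    destruct (L1 eps) as [N HN].
    exists (Nat.max N (4 * nu)); intros n Hn.
    assert (n0 : 0 < / INR n) by (apply Rinv_0_lt_compat, lt_0_INR; lia).
    specialize (HN n ltac:(lia)); specialize (HK n ltac:(lia)).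
    rewrite Rminus_0_r, pow_1 in HN.
    change (Rabs (cos_csc_sum n nu - cos_csc_approx n nu) <= eps * Rabs (/ INR n ^ 3)).
    rewrite <- pow_inv, (Rabs_pos_eq ((/ INR n) ^ 3)) by (apply pow_le; lra).
    eapply Rle_trans; [exact HK|].
    replace (K * (/ INR n) ^ 4) with (K * / INR n * (/ INR n) ^ 3) by ring.
    apply Rmult_le_compat_r; [apply pow_le; lra|].
    eapply Rle_trans; [apply Rle_abs | apply Rlt_le; exact HN].
  - apply is_lim_seq_abs_0.
    apply is_lim_seq_le_le_loc with (fun _ => 0) (fun n => K * (/ INR n) ^ 4).
    + exists (4 * nu)%nat; intros n Hn; split; [apply Rabs_pos | apply HK; auto].
    + apply is_lim_seq_const.
    + apply (L 3%nat).
Qed.
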